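(* Let $n\ge2$. The virtual product on $\mathcal{K}=\bigoplus_{l=0}^{n-1}\mathcal{K}_l$, i.e. the product $a*b:=\Gamma(\Gamma^{-1}(a)*\Gamma^{-1}(b))$ transported from the virtual product on $K(I\mathbb{P}(1,n))_{\mathbb{C}}$ by the vector space isomorphism $\Gamma$, is obtained by extending linearly the following (commutative) products of the generators $x_{00}$ and $1_{ml}$ ($m,l\in\{0,\dots,n-1\}$, first indices taken modulo $n$): 1. $1_{00}*1_{00}=1_{00}$, $\quad 1_{00}*x_{00}=x_{00}$, $\quad x_{00}*x_{00}=2x_{00}-1_{00}$; 2. $1_{00}*1_{m0}=1_{m0}$ and $x_{00}*1_{m0}=1_{m0}$ if $m\ne0$; 3. $1_{m_10}*1_{m_20}=0$ if $m_1,m_2\ne0$; 4. $1_{0l}*1_{ml}=1_{ml}$; 5. $x_{00}*1_{ml}=0$ if $l\ne0$; 6. $1_{m_1l}*1_{m_2l}=(1-\zeta^{-l})\,1_{(m_1+m_2)l}$ if $m_1+m_2\ne n$ and $m_1,m_2\ne0$; 7. $1_{m_1l}*1_{m_2l}=(1-\zeta^{-l})^2\,1_{0l}$ if $m_1+m_2=n$ and $m_1,m_2\ne0$; 8. $1_{m_1l_1}*1_{m_2l_2}=0$ if $l_1\ne l_2$.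
   Context: **Virtual K-theory of $\mathbb{P}(1,n)$.** Fix $n\ge2$, $\zeta=\exp(2\pi i/n)$, $G=\mathbb{C}^*$. Let $X=\mathbb{C}^2\setminus\{(0,0)\}$ with the action $\lambda\cdot(z_1,z_2)=(\lambda z_1,\lambda^n z_2)$; $\mathbb{P}(1,n)=[X/G]$. The inertia manifold is $I_GX=\coprod_{m\in\mathbb{Z}/n\mathbb{Z}}X^m$, with $X^m$ the fixed locus of $\zeta^m$, and $K(I\mathbb{P}(1,n))_{\mathbb{C}}=K_G(I_GX)\otimes\mathbb{C}$. As a vector space it is $\bigoplus_{m=0}^{n-1}A_m$ with $$A_0=\frac{\mathbb{C}[x_0^{\pm1}]}{\langle (x_0-1)(x_0^n-1)\rangle},\qquad A_m=\frac{\mathbb{C}[x_m^{\pm1}]}{\langle x_m^n-1\rangle}\quad(1\le m\le n-1).$$ The virtual product $*$ is the $\mathbb{C}$-bilinear product with, for $a_1,a_2\in\mathbb{Z}$ and $m_1,m_2\in\{0,\dots,n-1\}$ (index $m_1+m_2$ taken mod $n$), $$x_{m_1}^{a_1}*x_{m_2}^{a_2}=x_{m_1+m_2}^{a_1+a_2}\cdot e(m_1,m_2),$$ where the product on the right is the ordinary one in $A_{m_1+m_2}$ and $e(m_1,m_2)=1$ if $m_1=0$ or $m_2=0$; $e(m_1,m_2)=(1-x_0^{-1})^2$ if $m_1,m_2\ne0$ and $m_1+m_2=n$; $e(m_1,m_2)=1-x_{m_1+m_2}^{-1}$ otherwise. **Localization.** For $m,l\in\{0,\dots,n-1\}$ let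 $I_{00}=\langle(x_{00}-1)^2\rangle$ and $I_{ml}=\langle x_{ml}-\zeta^l\rangle$ for $(m,l)\ne(0,0)$. Put $\mathcal{K}_l=\bigoplus_{m=0}^{n-1}\mathbb{C}[x_{ml}^{\pm1}]/I_{ml}$ (the localization of $K_G(I_GX)\otimes\mathbb{C}$ at the maximal ideal $\langle x-\zeta^l\rangle$ of $R(G)\otimes\mathbb{C}=\mathbb{C}[x^{\pm1}]$) and $\mathcal{K}=\bigoplus_{l=0}^{n-1}\mathcal{K}_l$; $1_{ml}$ is the identity of $\mathbb{C}[x_{ml}^{\pm1}]/I_{ml}$. The map $\Gamma:K(I\mathbb{P}(1,n))_{\mathbb{C}}\to\mathcal{K}$ sends $f(x_m)\in A_m$ to the tuple of classes of $f(x_{ml})$, $l=0,\dots,n-1$; it is an isomorphism of vector spaces. *)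

(* Defs.v *)
From HB Require Import structures.
From mathcomp Require Import all_boot all_order all_algebra.
From mathcomp Require Import complex ring.
From mathcomp Require Import boolp classical_sets reals trigo.

Set Implicit Arguments.
Unset Strict Implicit.
Unset Printing Implicit Defensive.

Import Order.TTheory GRing.Theory Num.Theory.
Local Open Scope ring_scope.
Local Open Scope quotient_scope.

(** [F[x, x^-1]] is the subring of the fraction field [F(x)] whose elements are
    the [p / x^k] with [p] a polynomial and [k] a natural number. *)
Section Laurent.
Variable F : fieldType.
Local Notation "p %:F" := (@FracField.tofrac _ p).
Implicit Types (p : {poly F}) (f : {fraction {poly F}}).

Definition laurent_pred : {pred {fraction {poly F}}} :=
  fun f => `[< exists p (k : nat), f = p%:F / 'X%:F ^+ k >].

Lemma laurent_predP f :
  reflect (exists p (k : nat), f = p%:F / 'X%:F ^+ k) (f \in laurent_pred).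
Proof. exact: asboolP. Qed.

Lemma fracX_neq0 : ('X : {poly F})%:F != 0.
Proof. by rewrite tofrac_eq0 polyX_eq0. Qed.

Lemma laurent_subring : subring_closed laurent_pred.
Proof.
have X0 k : ('X : {poly F})%:F ^+ k != 0 by rewrite expf_neq0 ?fracX_neq0.
split.
- by apply/laurent_predP; exists 1, 0%N; rewrite tofrac1 expr0 divr1.
- move=> _ _ /laurent_predP[p [k ->]] /laurent_predP[q [j ->]].
  apply/laurent_predP; exists (p * 'X^j - q * 'X^k), (k + j)%N.
  by rewrite tofracB !tofracM !tofracXn exprD -mulNr addf_div // mulNr.
- move=> _ _ /laurent_predP[p [k ->]] /laurent_predP[q [j ->]].
  apply/laurent_predP; exists (p * q), (k + j)%N.
  by rewrite tofracM exprD mulf_div.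
Qed.

HB.instance Definition _ :=
  GRing.isSubringClosed.Build {fraction {poly F}} laurent_pred laurent_subring.

Record laurent : Type :=
  Laurent { laurent_val : {fraction {poly F}}; _ : laurent_val \in laurent_pred }.

HB.instance Definition _ := [isSub for laurent_val].
HB.instance Definition _ := [Choice of laurent by <:].
HB.instance Definition _ := [SubChoice_isSubComNzRing of laurent by <:].

Lemma poly_laurent_subproof p : p%:F \in laurent_pred.
Proof. by apply/laurent_predP; exists p, 0%N; rewrite expr0 divr1. Qed.

Definition poly_laurent p : laurent := Laurent (poly_laurent_subproof p).

Lemma poly_laurent_is_zmod_morphism : zmod_morphism poly_laurent.
Proof. by move=> p q; apply: val_inj; rewrite /= tofracB. Qed.

Lemma poly_laurent_is_monoid_morphism : monoid_morphism poly_laurent.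
Proof.
by split=> [|p q]; apply: val_inj; rewrite /= ?tofrac1 // tofracM.
Qed.

HB.instance Definition _ :=
  GRing.isZmodMorphism.Build {poly F} laurent poly_laurent
    poly_laurent_is_zmod_morphism.
HB.instance Definition _ :=
  GRing.isMonoidMorphism.Build {poly F} laurent poly_laurent
    poly_laurent_is_monoid_morphism.

Definition laurent_scale (c : F) (u : laurent) : laurent :=
  poly_laurent c%:P * u.

Fact laurent_scaleA a b u :
  laurent_scale a (laurent_scale b u) = laurent_scale (a * b) u.
Proof. by rewrite /laurent_scale mulrA -rmorphM -polyCM. Qed.
Fact laurent_scale1 : left_id 1 laurent_scale.
Proof. by move=> u; rewrite /laurent_scale polyC1 rmorph1 mul1r. Qed.
Fact laurent_scaleDr : right_distributive laurent_scale +%R.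
Proof. by move=> a u v; rewrite /laurent_scale mulrDr. Qed.
Fact laurent_scaleDl u : {morph laurent_scale^~ u : a b / a + b}.
Proof. by move=> a b; rewrite /laurent_scale polyCD rmorphD mulrDl. Qed.
Fact laurent_scaleAl a u v :
  laurent_scale a (u * v) = laurent_scale a u * v.
Proof. by rewrite /laurent_scale mulrA. Qed.

HB.instance Definition _ := GRing.Zmodule_isLmodule.Build F laurent
  laurent_scaleA laurent_scale1 laurent_scaleDr laurent_scaleDl.
HB.instance Definition _ :=
  GRing.Lmodule_isLalgebra.Build F laurent laurent_scaleAl.
HB.instance Definition _ := GRing.Lalgebra_isComAlgebra.Build F laurent.

Lemma laurent_mon_subproof (a : int) : ('X : {poly F})%:F ^ a \in laurent_pred.
Proof.
apply/laurent_predP; case: a => k.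
  by exists 'X^k, 0%N; rewrite expr0 divr1 tofracXn.
by exists 1, k.+1; rewrite tofrac1 div1r.
Qed.

Definition laurent_mon (a : int) : laurent := Laurent (laurent_mon_subproof a).

Lemma laurent_monD a b : laurent_mon (a + b) = laurent_mon a * laurent_mon b.
Proof. by apply: val_inj; rewrite /= expfzDr // fracX_neq0. Qed.

Lemma laurent_mon0 : laurent_mon 0 = 1.
Proof. exact: val_inj. Qed.

Lemma laurent_mon_nat (k : nat) : laurent_mon k = poly_laurent 'X^k.
Proof. by apply: val_inj; rewrite /= tofracXn. Qed.

Lemma laurent_polyP (u : laurent) :
  exists p (k : nat), u = poly_laurent p * laurent_mon (- k%:Z).
Proof.
have /laurent_predP[p [k e]] := valP u; exists p, k.
by apply: val_inj; rewrite /= -invr_expz.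
Qed.

End Laurent.

Section PrincipalQuotient.
Variables (F : fieldType) (A : comAlgType F) (h : A).
Implicit Types (u v : A).

Definition pideal : {pred A} := fun u => `[< exists v, u = v * h >].

Lemma pidealP u : reflect (exists v, u = v * h) (u \in pideal).
Proof. exact: asboolP. Qed.

Lemma pideal_zmod_closed : zmod_closed pideal.
Proof.
split=> [|_ _ /pidealP[u ->] /pidealP[v ->]]; apply/pidealP.
  by exists 0; rewrite mul0r.
by exists (u - v); rewrite mulrBl.
Qed.

HB.instance Definition _ := GRing.isZmodClosed.Build A pideal pideal_zmod_closed.

Lemma pidealM u v : v \in pideal -> u * v \in pideal.
Proof.
by move=> /pidealP[w ->]; apply/pidealP; exists (u * w); rewrite mulrA.
Qed.

(** [Quotient.quot] only carries a ring structure for proper ideals; the ring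
    and module structures of [pquot] make sense for all principal ideals. *)
Definition pquot : Type := Quotient.quot pideal.

HB.instance Definition _ := GRing.Zmodule.on pquot.
HB.instance Definition _ := Quotient.on pquot.

Definition pclass (u : A) : pquot := \pi_(Quotient.quot pideal) u.
Definition prepr (x : pquot) : A := repr (x : Quotient.quot pideal).

Lemma preprK : cancel prepr pclass.
Proof. by move=> x; rewrite /pclass reprK. Qed.

Lemma pclass_eqP u v : reflect (pclass u = pclass v) (u - v \in pideal).
Proof. by rewrite Quotient.idealrBE; apply: eqP. Qed.

Lemma pclass_is_zmod_morphism : zmod_morphism pclass.
Proof. by move=> u v; rewrite /pclass raddfB. Qed.

HB.instance Definition _ :=
  GRing.isZmodMorphism.Build A pquot pclass pclass_is_zmod_morphism.

Definition pone : pquot := pclass 1.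
Definition pmul (x y : pquot) : pquot := pclass (prepr x * prepr y).
Definition pscale (c : F) (x : pquot) : pquot := pclass (c *: prepr x).

Lemma prepr_pclass u : exists v, prepr (pclass u) = u + v * h.
Proof.
have /pclass_eqP/pidealP[v e] := preprK (pclass u).
by exists v; rewrite -e addrC subrK.
Qed.

Lemma pmulE u v : pmul (pclass u) (pclass v) = pclass (u * v).
Proof.
have [[u' eu] [v' ev]] := (prepr_pclass u, prepr_pclass v).
apply/pclass_eqP/pidealP; rewrite eu ev.
exists (u * v' + u' * v + u' * v' * h).
by rewrite !mulrDr !mulrDl; ring.
Qed.

Fact pmulA : associative pmul.
Proof.
by move=> x y z; rewrite -[x]preprK -[y]preprK -[z]preprK !pmulE mulrA.
Qed.
Fact pmulC : commutative pmul.
Proof. by move=> x y; rewrite /pmul mulrC. Qed.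
Fact pmul1 : left_id pone pmul.
Proof. by move=> x; rewrite -[x]preprK pmulE mul1r. Qed.
Fact pmulDl : left_distributive pmul +%R.
Proof.
move=> x y z; rewrite -[x]preprK -[y]preprK -[z]preprK.
by rewrite -raddfD !pmulE mulrDl raddfD.
Qed.

HB.instance Definition _ :=
  GRing.Zmodule_isComPzRing.Build pquot pmulA pmulC pmul1 pmulDl.

Lemma pclass_is_monoid_morphism : monoid_morphism pclass.
Proof. by split=> // u v; rewrite -pmulE. Qed.

HB.instance Definition _ :=
  GRing.isMonoidMorphism.Build A pquot pclass pclass_is_monoid_morphism.

Lemma pscaleE c u : pscale c (pclass u) = pclass (c *: u).
Proof.
have [v ev] := prepr_pclass u; apply/pclass_eqP/pidealP; exists (c *: v).
by rewrite ev scalerDr addrC addKr scalerAl.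
Qed.

Fact pscaleA a b x : pscale a (pscale b x) = pscale (a * b) x.
Proof. by rewrite -[x]preprK !pscaleE scalerA. Qed.
Fact pscale1 : left_id 1 pscale.
Proof. by move=> x; rewrite -[x]preprK pscaleE scale1r. Qed.
Fact pscaleDr : right_distributive pscale +%R.
Proof.
move=> a x y; rewrite -[x]preprK -[y]preprK.
by rewrite -raddfD !pscaleE scalerDr raddfD.
Qed.
Fact pscaleDl x : {morph pscale^~ x : a b / a + b}.
Proof. by move=> a b; rewrite -[x]preprK !pscaleE scalerDl raddfD. Qed.

HB.instance Definition _ := GRing.Zmodule_isLmodule.Build F pquot
  pscaleA pscale1 pscaleDr pscaleDl.

Lemma pclassZ c u : pclass (c *: u) = c *: pclass u.
Proof. by rewrite -pscaleE. Qed.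

HB.instance Definition _ :=
  GRing.isScalable.Build F A pquot *:%R pclass pclassZ.

Lemma pquot_scalerAl c (x y : pquot) : c *: (x * y) = (c *: x) * y.
Proof.
rewrite -[x]preprK -[y]preprK -rmorphM -!pclassZ -rmorphM.
by rewrite scalerAl.
Qed.

Lemma pclass_eq0P u : reflect (pclass u = 0) (u \in pideal).
Proof.
have -> : (u \in pideal) = (u - 0 \in pideal) by rewrite subr0.
by apply: (iffP (pclass_eqP u 0)); rewrite raddf0.
Qed.

End PrincipalQuotient.

Section InducedMap.
Variables (F : fieldType) (A : comAlgType F).

(** The class of [u] modulo [h] is sent to the class of [u] modulo [h']. This
    does not depend on [u] when [h'] divides [h]. *)
Definition pmap (h h' : A) (x : pquot h) : pquot h' := pclass h' (prepr x).

Lemma pmapE (h h' u : A) : h \in pideal h' -> pmap h' (pclass h u) = pclass h' u.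
Proof.
move=> hh'; have [v ev] := prepr_pclass h u.
by apply/pclass_eqP; rewrite ev addrC addKr pidealM.
Qed.

Lemma pmap_linear (h h' : A) : h \in pideal h' -> linear (@pmap h h').
Proof.
move=> hh' c x y; rewrite -[x](@preprK _ _ h) -[y](@preprK _ _ h).
by rewrite -linearP !pmapE // linearP.
Qed.

End InducedMap.

Section CRT.
Variables (F : fieldType) (A : comAlgType F).
Implicit Types (a b c f : A).

Definition comaximal a b := exists u v, u * a + v * b = 1.

Lemma comaximalC a b : comaximal a b -> comaximal b a.
Proof. by move=> [u [v e]]; exists v, u; rewrite addrC. Qed.

Lemma comaximalM a b c : comaximal a b -> comaximal a c -> comaximal a (b * c).
Proof.
move=> [u [v e]] [u' [v' e']].
exists (u * u' * a + u * v' * c + v * b * u'), (v * v').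
by transitivity ((u * a + v * b) * (u' * a + v' * c)); [ring | rewrite e e' mulr1].
Qed.

Lemma comaximal_prod (I : Type) (s : seq I) (P : pred I) (h : I -> A) a :
  (forall i, P i -> comaximal a (h i)) -> comaximal a (\prod_(i <- s | P i) h i).
Proof.
move=> H; elim/big_ind: _ => //.
- by exists 0, 1; rewrite mul0r mul1r add0r.
- exact: comaximalM.
Qed.

Variables (I : finType) (h : I -> A).
Hypothesis hco : forall i j, i != j -> comaximal (h i) (h j).

Lemma crt_inj f : (forall i, f \in pideal (h i)) -> f \in pideal (\prod_i h i).
Proof.
move=> H; rewrite -big_enum; elim: (enum I) (enum_uniq I) => [_|i s IH] /=.
  by rewrite big_nil; apply/pidealP; exists f; rewrite mulr1.
move=> /andP[iNs us]; rewrite big_cons.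
have [a ea] := pidealP _ _ (H i); have [b eb] := pidealP _ _ (IH us).
have [u [v e]] : comaximal (h i) (\prod_(j <- s) h j).
  rewrite big_seq; apply: comaximal_prod => j js.
  by apply: hco; apply: contraNneq iNs => ->.
apply/pidealP; exists (u * b + v * a).
set p := \prod_(j <- s) h j in eb e *.
rewrite -[LHS]mul1r -e mulrDl {1}eb ea; ring.
Qed.

Lemma crt_surj (g : I -> A) : exists f, forall i, f - g i \in pideal (h i).
Proof.
have E i : exists e, e - 1 \in pideal (h i) /\
    forall j, j != i -> e \in pideal (h j).
  have [u [v e]] : comaximal (h i) (\prod_(j | j != i) h j).
    by apply: comaximal_prod => j; rewrite eq_sym; apply: hco.
  exists (v * \prod_(j | j != i) h j); split.
    by apply/pidealP; exists (- u); rewrite -[X in _ - X]e opprD addrCA subrr addr0 mulNr.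
  move=> j ji; apply: pidealM; rewrite (bigD1 j) //= mulrC pidealM //.
  by apply/pidealP; exists 1; rewrite mul1r.
have [e He] := choice E.
exists (\sum_i g i * e i) => i; rewrite (bigD1 i) //= addrAC.
rewrite -[X in _ - X]mulr1 -mulrBr rpredD ?pidealM ?(He i).1 //.
apply: rpred_sum => j ji; apply: pidealM; apply: (He j).2.
by rewrite eq_sym.
Qed.

End CRT.

Section DirectSum.
Variables (F : fieldType) (I : finType) (V : I -> lmodType F).

Definition dsum : Type := {dffun forall i : I, V i}.

HB.instance Definition _ := Choice.on dsum.

Definition dsum_mk (f : forall i, V i) : dsum := finfun f.
Definition dproj (i : I) (x : dsum) : V i :=
  (x : {dffun forall i : I, V i}) i.

Lemma dprojE f i : dproj i (dsum_mk f) = f i.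
Proof. exact: ffunE. Qed.

Lemma dsumP (x y : dsum) : (forall i, dproj i x = dproj i y) <-> x = y.
Proof. exact: ffunP. Qed.

Definition dzero := dsum_mk (fun=> 0).
Definition dopp x := dsum_mk (fun i => - dproj i x).
Definition dadd x y := dsum_mk (fun i => dproj i x + dproj i y).
Definition dscale (c : F) x := dsum_mk (fun i => c *: dproj i x).

Fact daddA : associative dadd.
Proof. by move=> x y z; apply/dsumP => i; rewrite !dprojE addrA. Qed.
Fact daddC : commutative dadd.
Proof. by move=> x y; apply/dsumP => i; rewrite !dprojE addrC. Qed.
Fact dadd0 : left_id dzero dadd.
Proof. by move=> x; apply/dsumP => i; rewrite !dprojE add0r. Qed.
Fact daddN : left_inverse dzero dopp dadd.
Proof. by move=> x; apply/dsumP => i; rewrite !dprojE addNr. Qed.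

HB.instance Definition _ :=
  GRing.isZmodule.Build dsum daddA daddC dadd0 daddN.

Fact dscaleA a b x : dscale a (dscale b x) = dscale (a * b) x.
Proof. by apply/dsumP => i; rewrite !dprojE scalerA. Qed.
Fact dscale1 : left_id 1 dscale.
Proof. by move=> x; apply/dsumP => i; rewrite !dprojE scale1r. Qed.
Fact dscaleDr : right_distributive dscale +%R.
Proof. by move=> a x y; apply/dsumP => i; rewrite !dprojE scalerDr. Qed.
Fact dscaleDl x : {morph dscale^~ x : a b / a + b}.
Proof. by move=> a b; apply/dsumP => i; rewrite !dprojE scalerDl. Qed.

HB.instance Definition _ := GRing.Zmodule_isLmodule.Build F dsum
  dscaleA dscale1 dscaleDr dscaleDl.

Lemma dproj_is_linear i : linear (dproj i).
Proof.
move=> c x y; have -> : c *: x + y = dadd (dscale c x) y by [].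
by rewrite !dprojE.
Qed.

Lemma dprojP i c x y : dproj i (c *: x + y) = c *: dproj i x + dproj i y.
Proof. exact: dproj_is_linear. Qed.

HB.instance Definition _ i :=
  GRing.isLinear.Build F dsum (V i) *:%R (dproj i) (dproj_is_linear i).

Definition dinj (i : I) (v : V i) : dsum :=
  dsum_mk (fun j => dfwith (fun k => 0 : V k) v j).

Lemma dinj_is_linear i : linear (@dinj i).
Proof.
move=> c u v; apply/dsumP => j; rewrite linearP /= !dprojE.
have [<-|ij] := eqVneq i j; first by rewrite !dfwith_in.
by rewrite !dfwith_out // scaler0 addr0.
Qed.

HB.instance Definition _ i :=
  GRing.isLinear.Build F (V i) dsum *:%R (@dinj i) (@dinj_is_linear i).

Lemma dproj_dinj i v : dproj i (@dinj i v) = v.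
Proof. by rewrite dprojE dfwith_in. Qed.

Lemma dproj_dinj_neq i j v : i != j -> dproj j (@dinj i v) = 0.
Proof. by move=> ij; rewrite dprojE dfwith_out. Qed.

Lemma dsum_sum x : x = \sum_i dinj (dproj i x).
Proof.
apply/dsumP => j; rewrite raddf_sum (bigD1 j) //= dproj_dinj big1 ?addr0 //.
by move=> i ij; rewrite dproj_dinj_neq.
Qed.

End DirectSum.

Section Zeta.
Variable R : realType.

(** [exp (2 pi i / n)], through Euler's formula. *)
Definition zeta (n : nat) : R[i] :=
  (cos (2 * pi / n%:R) +i* sin (2 * pi / n%:R))%C.

Lemma zetaX n k :
  zeta n ^+ k = (cos (2 * pi / n%:R * k%:R) +i* sin (2 * pi / n%:R * k%:R))%C.
Proof.
elim: k => [|k IH]; first by rewrite expr0 mulr0 cos0 sin0.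
set t := 2 * pi / n%:R in IH *; rewrite exprSr IH.
have -> : t * k.+1%:R = t * k%:R + t by rewrite -[k.+1%:R]natr1 mulrDr mulr1.
by rewrite cosD sinD; congr (_ +i* _)%C; rewrite addrC.
Qed.

Lemma cos_lt_2pi_neq1 (x : R) : 0 < x < 2 * pi -> cos x != 1.
Proof.
move=> /andP[x0 xpi]; apply/eqP => c1.
have s0 : 0 < sin (x / 2).
  apply: sin_gt0_pi; rewrite divr_gt0 //= ltr_pdivrMr // mulrC.
  by [].
have e : cos x = cos (x / 2) ^+ 2 - sin (x / 2) ^+ 2.
  by rewrite {1}[x]splitr cosD !expr2.
have /eqP : sin (x / 2) ^+ 2 *+ 2 = 0.
  set c := cos (x / 2) in e *; set s := sin (x / 2) in e *.
  transitivity ((c ^+ 2 + s ^+ 2) - (c ^+ 2 - s ^+ 2)); first by ring.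
  by rewrite -e c1 cos2Dsin2 subrr.
by rewrite mulrn_eq0 /= sqrf_eq0 gt_eqF.
Qed.

Lemma zeta_prim n : (0 < n)%N -> n.-primitive_root (zeta n).
Proof.
move=> n0; rewrite /primitive_root_of_unity n0 /=; apply/forallP => i.
have nR : n%:R != 0 :> R by rewrite pnatr_eq0 -lt0n.
rewrite unity_rootE zetaX; apply/eqP; have [->|/eqP ni] := i.+1 =P n.
  by rewrite mulfVK // mulr_natl cos2pi sin2pi eqxx.
apply/negbTE.
have ltin : (i.+1 < n)%N by rewrite ltn_neqAle ni ltn_ord.
rewrite eq_complex /=; apply/nandP; left.
apply: cos_lt_2pi_neq1.
have p0 : 0 < 2 * pi :> R by rewrite mulr_gt0 ?pi_gt0.
apply/andP; split; first by rewrite mulr_gt0 ?divr_gt0 ?ltr0n.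
rewrite mulrAC ltr_pdivrMr ?ltr0n // ltr_pM2l // ltr_nat //.
Qed.

End Zeta.

(** Indices in [{0, ..., n-1}] live in ['Z_n], whose addition is modulo [n];
    this is only meaningful for [1 < n]. Below, [m] indexes the components of
    the inertia manifold and [l] the points [zeta ^ l] of localization. *)
Section VirtualKTheory.
Variables (R : realType) (n : nat).

Local Notation C := R[i].
Local Notation L := (laurent C).
Local Notation x := (laurent_mon C 1).

Definition KI_gen (m : 'Z_n) : L :=
  if m == 0 then (x - 1) * (x ^+ n - 1) else x ^+ n - 1.

Definition KI_summand (m : 'Z_n) : lmodType C := pquot (KI_gen m).

(** [K(IP(1,n))] with complex coefficients. *)
Definition KI : lmodType C := dsum KI_summand.

(** The class of [x_m ^ a] in the summand [A_m]. *)
Definition KI_mon (m : 'Z_n) (a : int) : pquot (KI_gen m) :=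
  pclass (KI_gen m) (laurent_mon C a).

(** The factor [e(m1, m2)]; the sum in the second test is taken in [nat]. *)
Definition KI_euler (m1 m2 : 'Z_n) : pquot (KI_gen (m1 + m2)) :=
  if (m1 == 0) || (m2 == 0) then 1
  else if (m1 + m2 == n)%N then (1 - KI_mon (m1 + m2) (- 1)) ^+ 2
  else 1 - KI_mon (m1 + m2) (- 1).

(** [f(x_m1) * g(x_m2)], as an element of [A_(m1+m2)]; by [KI_mul_class]
    below it does not depend on the representatives [f] and [g], although
    [f(x_(m1+m2))] and [g(x_(m1+m2))] alone may. *)
Definition KI_mul (m1 m2 : 'Z_n) (y : KI_summand m1) (z : KI_summand m2) :
    KI_summand (m1 + m2) :=
  pmap (KI_gen (m1 + m2)) (y : pquot (KI_gen m1)) *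
  pmap (KI_gen (m1 + m2)) (z : pquot (KI_gen m2)) * KI_euler m1 m2.

Definition KI_in (m : 'Z_n) (y : KI_summand m) : KI := dinj y.

Definition vprod (a b : KI) : KI :=
  \sum_(m1 : 'Z_n) \sum_(m2 : 'Z_n) KI_in (KI_mul (dproj m1 a) (dproj m2 b)).

Definition Kl_gen (m l : 'Z_n) : L :=
  if (m == 0) && (l == 0) then (x - 1) ^+ 2 else x - (zeta R n ^+ l)%:A.

Definition Kl_summand (l m : 'Z_n) : lmodType C := pquot (Kl_gen m l).

Definition Kl (l : 'Z_n) : lmodType C := dsum (Kl_summand l).

Definition Kloc : lmodType C := dsum Kl.

Definition Gamma (a : KI) : Kloc :=
  dsum_mk (V := Kl) (fun l => dsum_mk (V := Kl_summand l) (fun m =>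
    pmap (Kl_gen m l) (dproj m a : pquot (KI_gen m)))).

(** The inverse of [Gamma] when [1 < n], see [GammaK] and [Gamma_invK]. *)
Definition Gamma_inv (b : Kloc) : KI := xget 0 [set a | Gamma a = b]%classic.

Definition Kprod (a b : Kloc) : Kloc := Gamma (vprod (Gamma_inv a) (Gamma_inv b)).

Definition Kl_in (m l : 'Z_n) (u : pquot (Kl_gen m l)) : Kloc :=
  dinj (V := Kl) (dinj (V := Kl_summand l) (i := m) u).

Definition K_one (m l : 'Z_n) : Kloc := @Kl_in m l 1.

Definition K_x00 : Kloc := @Kl_in 0 0 (pclass (Kl_gen 0 0) x).

(** The basis candidates [x_00] ([None]) and [1_ml] ([Some (m, l)]). *)
Definition generator (g : option ('Z_n * 'Z_n)) : Kloc :=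
  if g is Some (m, l) then K_one m l else K_x00.

Local Notation "1_[ m , l ]" := (K_one m l) (at level 0, m, l at level 99).
Local Notation z := (zeta R n).

(** Sums of first indices are in ['Z_n], except in the comparisons with [n],
    which take place in [nat]. *)
Record product_table (op : Kloc -> Kloc -> Kloc) : Prop := ProductTable {
  op_one_one : op 1_[0, 0] 1_[0, 0] = 1_[0, 0];
  op_one_x : op 1_[0, 0] K_x00 = K_x00;
  op_x_x : op K_x00 K_x00 = 2 *: K_x00 - 1_[0, 0];
  op_one_twisted : forall m : 'Z_n, m != 0 -> op 1_[0, 0] 1_[m, 0] = 1_[m, 0];
  op_x_twisted : forall m : 'Z_n, m != 0 -> op K_x00 1_[m, 0] = 1_[m, 0];
  op_twisted_twisted : forall m1 m2 : 'Z_n, m1 != 0 -> m2 != 0 ->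
    op 1_[m1, 0] 1_[m2, 0] = 0;
  op_unit : forall m l : 'Z_n, op 1_[0, l] 1_[m, l] = 1_[m, l];
  op_x_neq : forall m l : 'Z_n, l != 0 -> op K_x00 1_[m, l] = 0;
  op_sum_neq : forall m1 m2 l : 'Z_n,
    (m1 + m2 != n)%N -> m1 != 0 -> m2 != 0 ->
    op 1_[m1, l] 1_[m2, l] = (1 - z ^- l) *: 1_[m1 + m2, l];
  op_sum_eq : forall m1 m2 l : 'Z_n,
    (m1 + m2 = n)%N -> m1 != 0 -> m2 != 0 ->
    op 1_[m1, l] 1_[m2, l] = (1 - z ^- l) ^+ 2 *: 1_[0, l];
  op_neq : forall m1 m2 l1 l2 : 'Z_n, l1 != l2 -> op 1_[m1, l1] 1_[m2, l2] = 0
}.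

Lemma laurent_xE : x = poly_laurent 'X.
Proof. exact: (laurent_mon_nat C 1). Qed.

Lemma laurent_XsubC (c : C) : poly_laurent ('X - c%:P) = x - c%:A.
Proof.
by rewrite rmorphB /= laurent_xE; congr (_ - _); apply/esym/mulr1.
Qed.

Hypothesis n_gt1 : (1 < n)%N.

Lemma prod_Kl_gen m : \prod_(l : 'Z_n) Kl_gen m l = KI_gen m.
Proof.
have P : \prod_(l : 'Z_n) (x - (zeta R n ^+ l)%:A) = x ^+ n - 1.
  have H := factor_Xn_sub_1 (zeta_prim R (ltnW n_gt1)).
  have /(congr1 (@poly_laurent C)) := H.
  rewrite rmorphB rmorphXn rmorph1 /= -laurent_xE => <-.
  rewrite -[in index_iota 0 n](Zp_cast n_gt1) big_mkord rmorph_prod.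
  by apply: eq_bigr => l _; exact/esym/laurent_XsubC.
have x1 : x - 1 = x - (zeta R n ^+ (0%R : 'Z_n))%:A by rewrite expr0 scale1r.
rewrite (eq_bigr (fun l : 'Z_n => (if (m == 0) && (l == 0) then x - 1 else 1) *
    (x - (zeta R n ^+ l)%:A))) => [|l _].
  rewrite big_split /= P /KI_gen; case: (m == 0) => /=.
    by rewrite -big_mkcond /= big_pred1_eq.
  by rewrite big1_eq mul1r.
rewrite /Kl_gen; have [->|_] := eqVneq l 0; last first.
  by rewrite andbF; apply/esym/mul1r.
by case: (m == 0) => /=; [rewrite -x1 expr2 | apply/esym/mul1r].
Qed.

Lemma zeta_inj (l l' : 'Z_n) : l != l' -> zeta R n ^+ l != zeta R n ^+ l'.
Proof.
apply: contraNneq => /eqP; rewrite (eq_prim_root_expr (zeta_prim R (ltnW n_gt1))).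
have lt_n (k : 'Z_n) : (k < n)%N.
  exact: leq_trans (ltn_ord k) (eq_leq (Zp_cast n_gt1)).
by rewrite !modn_small.
Qed.

Lemma comaximal_XsubC (a b : C) : a != b -> comaximal (x - a%:A) (x - b%:A).
Proof.
move=> ab; exists (((b - a)^-1)%:A), (- ((b - a)^-1)%:A).
rewrite mulNr -mulrBr.
have -> : x - a%:A - (x - b%:A) = (b - a)%:A by rewrite scalerBl; ring.
by rewrite -scalerAl mul1r scalerA mulVf ?scale1r // subr_eq0 eq_sym.
Qed.

Lemma comaximal_Kl_gen m (l l' : 'Z_n) :
  l != l' -> comaximal (Kl_gen m l) (Kl_gen m l').
Proof.
have x1 : x - 1 = x - (zeta R n ^+ (0%R : 'Z_n))%:A by rewrite expr0 scale1r.
move=> ll'; have co := comaximal_XsubC (zeta_inj ll').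
rewrite /Kl_gen; case: (m == 0) => //=; rewrite x1 expr2.
have [l0|_] := eqVneq l 0; have [l'0|_] := eqVneq l' 0 => //.
- by rewrite l0 l'0 eqxx in ll'.
- by rewrite l0 in co; apply/comaximalC/comaximalM; exact: comaximalC.
- by rewrite l'0 in co; exact: comaximalM.
Qed.

Lemma KI_gen_Kl m l : KI_gen m \in pideal (Kl_gen m l).
Proof.
rewrite -prod_Kl_gen (bigD1 l) //= mulrC pidealM //.
by apply/pidealP; exists 1; rewrite mul1r.
Qed.

Lemma GammaE m l a : dproj m (dproj l (Gamma a)) =
  pmap (Kl_gen m l) (dproj m a : pquot (KI_gen m)).
Proof. by rewrite 2!dprojE. Qed.

(** [Gamma] sends the class of [f(x_m)] to the tuple of classes of
    [f(x_ml)]. *)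
Lemma Gamma_class m l (f : L) :
  dproj m (dproj l (Gamma (KI_in (pclass (KI_gen m) f))))
  = pclass (Kl_gen m l) f.
Proof. by rewrite GammaE dproj_dinj pmapE // KI_gen_Kl. Qed.

Lemma Gamma_linear : linear Gamma.
Proof.
move=> c a b; apply/dsumP => l; apply/dsumP => m.
rewrite (dprojP l c (Gamma a)) (dprojP m c (dproj l (Gamma a))).
rewrite (GammaE m l a) (GammaE m l b) (GammaE m l (c *: a + b)) (dprojP m c a).
apply: pmap_linear; exact: KI_gen_Kl.
Qed.

Lemma Gamma_bij : bijective Gamma.
Proof.
have inj : injective Gamma.
  move=> a b ab; apply/dsumP => m.
  rewrite -[dproj m a](preprK (dproj m a : pquot (KI_gen m))).
  rewrite -[dproj m b](preprK (dproj m b : pquot (KI_gen m))).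
  apply/pclass_eqP; set f := _ - _.
  suff : f \in pideal (\prod_l Kl_gen m l) by rewrite prod_Kl_gen.
  apply: crt_inj => [|l].
    exact: comaximal_Kl_gen.
  have := congr1 (fun y : Kloc => dproj m (dproj l y)) ab.
  by rewrite (GammaE m l a) (GammaE m l b) => /pclass_eqP.
have surj (b : Kloc) : exists a, Gamma a = b.
  have H m : exists f : L, forall l,
      f - prepr (dproj m (dproj l b) : pquot (Kl_gen m l)) \in pideal (Kl_gen m l).
    by apply: crt_surj; exact: comaximal_Kl_gen.
  have [f fP] := choice H.
  exists (dsum_mk (V := KI_summand) (fun m => pclass (KI_gen m) (f m))).
  apply/dsumP => l; apply/dsumP => m; rewrite GammaE dprojE pmapE ?KI_gen_Kl //.
  by rewrite -[RHS](preprK (dproj m (dproj l b) : pquot (Kl_gen m l)));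
     apply/pclass_eqP.
have [g gP] := choice surj.
by exists g => // a; apply: inj.
Qed.

Lemma Gamma_invK : cancel Gamma_inv Gamma.
Proof.
move=> b; have [g _ gK] := Gamma_bij.
by apply: (xgetPex 0 (P := [set a | Gamma a = b]%classic)); exists (g b).
Qed.

Lemma GammaK : cancel Gamma Gamma_inv.
Proof. by move=> a; apply: (bij_inj Gamma_bij); rewrite Gamma_invK. Qed.

Lemma Zp_add_eq0 (m1 m2 : 'Z_n) :
  m1 != 0 -> m1 + m2 = 0 -> (m1 + m2 == n)%N.
Proof.
move=> m10 /(congr1 val) /= s0; move: (ltn_ord m1) (ltn_ord m2) s0.
have : (0 < m1)%N by rewrite lt0n; apply: contraNneq m10 => m10; apply/eqP/val_inj.
move: (val m1) (val m2) => a b; rewrite (Zp_cast n_gt1) => a0 an bn s0.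
have : (n %| a + b)%N by rewrite /dvdn s0.
case/dvdnP => [[|[|k]]] e; rewrite ?mul1n in e.
- by move: e; rewrite mul0n => /eqP; rewrite addn_eq0 -leqn0 leqNgt a0.
- exact/eqP.
- have : (a + b < n + n)%N by rewrite -addnS leq_add // ltnW.
  by rewrite e !mulSn addnA -ltn_subRL subnn.
Qed.

Lemma KI_euler_gen (m1 m2 m : 'Z_n) (u : L) :
    (m == m1) || (m == m2) ->
  pclass (KI_gen (m1 + m2)) (u * KI_gen m) * KI_euler m1 m2 = 0.
Proof.
move=> mE.
have [h|h] : (KI_gen m \in pideal (KI_gen (m1 + m2))) \/
   [/\ m != 0, m1 != 0, m2 != 0 & m1 + m2 == 0].
- have gE0 : KI_gen 0 = (x - 1) * (x ^+ n - 1) by rewrite /KI_gen eqxx.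
  have gE k : k != 0 -> KI_gen k = x ^+ n - 1 by rewrite /KI_gen => /negbTE ->.
  have refl (g : L) : g \in pideal g by apply/pidealP; exists 1; rewrite mul1r.
  have [s0|s0] := eqVneq (m1 + m2) 0; last first.
    left; rewrite (gE _ s0); have [->|m0] := eqVneq m 0; last by rewrite gE.
    by rewrite gE0 pidealM.
  have [->|m0] := eqVneq m 0; first by left; rewrite s0.
  right; split => //.
  + apply: contraNneq m0 => m10; move: s0 mE; rewrite m10 add0r => ->.
    by rewrite orbb.
  + apply: contraNneq m0 => m20; move: s0 mE; rewrite m20 addr0 => ->.
    by rewrite orbb.
- by have /pclass_eq0P -> := pidealM u h; rewrite mul0r.
have [m0 /negbTE m10 /negbTE m20 /eqP s0] := h.
have sn : (m1 + m2 == n)%N.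
  by apply: Zp_add_eq0; rewrite ?m10.
rewrite /KI_euler m10 m20 sn /= /KI_mon -(rmorph1 (pclass (KI_gen (m1 + m2)))).
rewrite -rmorphB -rmorphXn -rmorphM; apply/pclass_eq0P.
have -> : KI_gen m = x ^+ n - 1 by rewrite /KI_gen (negbTE m0).
have xV : x * laurent_mon C (- 1) = 1 by rewrite -laurent_monD subrr laurent_mon0.
rewrite s0 /KI_gen eqxx; apply/pidealP.
exists (u * laurent_mon C (- 1) * (1 - laurent_mon C (- 1))).
have e : 1 - laurent_mon C (- 1) = laurent_mon C (- 1) * (x - 1).
  by rewrite mulrBr mulr1 mulrC xV.
by rewrite [in LHS]expr2 {1}e; ring.
Qed.

Lemma KI_mul_class (m1 m2 : 'Z_n) (f g : L) :
  @KI_mul m1 m2 (pclass (KI_gen m1) f) (pclass (KI_gen m2) g) =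
  pclass (KI_gen (m1 + m2)) (f * g) * KI_euler m1 m2.
Proof.
rewrite /KI_mul /pmap.
have [v ->] := prepr_pclass (KI_gen m1) f.
have [w ->] := prepr_pclass (KI_gen m2) g.
rewrite -rmorphM.
have -> : (f + v * KI_gen m1) * (g + w * KI_gen m2) =
    f * g + f * w * KI_gen m2 + v * (g + w * KI_gen m2) * KI_gen m1 by ring.
by rewrite !rmorphD !mulrDl !KI_euler_gen ?eqxx ?orbT // !addr0.
Qed.

Lemma KI_mulDr (m1 m2 : 'Z_n) (y : KI_summand m1) : linear (@KI_mul m1 m2 y).
Proof.
move=> c z z'; rewrite -[y](@preprK _ _ (KI_gen m1)).
rewrite -[z](@preprK _ _ (KI_gen m2)) -[z'](@preprK _ _ (KI_gen m2)).
rewrite -linearP !KI_mul_class mulrDr -scalerAr linearP mulrDl.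
by rewrite -pquot_scalerAl.
Qed.

Lemma KI_mulDl (m1 m2 : 'Z_n) (z : KI_summand m2) :
  linear (fun y : KI_summand m1 => KI_mul y z).
Proof.
move=> c y y'; rewrite -[z](@preprK _ _ (KI_gen m2)).
rewrite -[y](@preprK _ _ (KI_gen m1)) -[y'](@preprK _ _ (KI_gen m1)).
rewrite -linearP !KI_mul_class mulrDl -scalerAl linearP mulrDl.
by rewrite -pquot_scalerAl.
Qed.

Lemma KI_inP (m : 'Z_n) c (y y' : KI_summand m) :
  KI_in (c *: y + y') = c *: KI_in y + KI_in y'.
Proof. exact: dinj_is_linear. Qed.

Lemma vprod_bilinear : bilinear_for *:%R *:%R vprod.
Proof.
split=> [b|a] c u v.
- transitivity (\sum_m1 \sum_m2
    (c *: KI_in (KI_mul (dproj m1 u) (dproj m2 b)) +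
     KI_in (KI_mul (dproj m1 v) (dproj m2 b)))).
    apply: eq_bigr => m1 _; apply: eq_bigr => m2 _.
    by rewrite -KI_inP dprojP; congr KI_in; exact: KI_mulDl.
  rewrite /= /vprod scaler_sumr -big_split; apply: eq_bigr => m1 _.
  by rewrite /= scaler_sumr -big_split.
- transitivity (\sum_m1 \sum_m2
    (c *: KI_in (KI_mul (dproj m1 a) (dproj m2 u)) +
     KI_in (KI_mul (dproj m1 a) (dproj m2 v)))).
    apply: eq_bigr => m1 _; apply: eq_bigr => m2 _.
    by rewrite -KI_inP dprojP; congr KI_in; exact: KI_mulDr.
  rewrite /= /vprod scaler_sumr -big_split; apply: eq_bigr => m1 _.
  by rewrite /= scaler_sumr -big_split.
Qed.

Lemma vprod_in (m1 m2 : 'Z_n) (y : KI_summand m1) (z : KI_summand m2) :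
  vprod (KI_in y) (KI_in z) = KI_in (KI_mul y z).
Proof.
have mul0l k1 k2 (w : KI_summand k2) : @KI_mul k1 k2 0 w = 0.
  have := KI_mulDl w 1 (0 : KI_summand k1) 0.
  rewrite !scale1r addr0 => /eqP.
  by rewrite -subr_eq subrr eq_sym => /eqP.
have mul0r k1 k2 (w : KI_summand k1) : @KI_mul k1 k2 w 0 = 0.
  have := KI_mulDr w 1 (0 : KI_summand k2) 0.
  rewrite !scale1r addr0 => /eqP.
  by rewrite -subr_eq subrr eq_sym => /eqP.
have in0 k : @KI_in k 0 = 0 by exact: (linear0 (dinj (V := KI_summand) (i := k))).
rewrite /vprod (bigD1 m1) //= [X in _ + X]big1 => [|k1 k1m]; last first.
  apply: big1 => k2 _; rewrite /KI_in (dproj_dinj_neq y) 1?eq_sym //.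
  by rewrite mul0l; exact: in0.
rewrite addr0 (bigD1 m2) //= [X in _ + X]big1 => [|k2 k2m]; last first.
  rewrite /KI_in (dproj_dinj_neq z) 1?eq_sym //.
  by rewrite mul0r; exact: in0.
by rewrite addr0 /KI_in !dproj_dinj.
Qed.

(** Together with [vprod_bilinear], this is the definition of the virtual
    product: [x_m1 ^ a1 * x_m2 ^ a2 = x_(m1+m2) ^ (a1 + a2) e(m1, m2)]. *)
Lemma vprod_mon (m1 m2 : 'Z_n) (a1 a2 : int) :
  vprod (KI_in (KI_mon m1 a1)) (KI_in (KI_mon m2 a2)) =
  KI_in (KI_mon (m1 + m2) (a1 + a2) * KI_euler m1 m2).
Proof. by rewrite vprod_in KI_mul_class -laurent_monD. Qed.

End VirtualKTheory.

(* Main.v *)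
(** By the Chinese remainder theorem, the class of [u] in the summand [(m, l)]
    of [K] lifts along [Gamma] to the class of a Laurent polynomial [f] that is
    congruent to [u] at [zeta ^ l] and vanishes at the other roots of unity.
    The virtual product of two such lifts is again a product of Laurent
    polynomials with an Euler factor, so it vanishes unless the two points of
    localization agree, and otherwise it is the class of [u * v * e(m1, m2)] in
    the summand [(m1 + m2, l)]. There [x] acts as [zeta ^ l] except at
    [(0, 0)], where [(x - 1) ^+ 2 = 0], which gives the table. Division by the
    linear or quadratic generators, which do not vanish at [0], shows that the
    generators form a basis, so a bilinear product is determined by the
    table. *)
Require Import Defs.
From HB Require Import structures.
From mathcomp Require Import all_boot all_order all_algebra.
From mathcomp Require Import complex ring boolp.
From mathcomp Require Import reals.

Set Implicit Arguments.
Unset Strict Implicit.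
Unset Printing Implicit Defensive.

Import Order.TTheory GRing.Theory Num.Theory.
Local Open Scope ring_scope.

(** Stated for a bare function with a proof of linearity, the form in which [bilinear_for] provides
    each argument of a product. *)
Lemma linear_expand (K : pzRingType) (V W : lmodType K) (f : V -> W)
    (I : finType) (c : I -> K) (v : I -> V) :
  linear f -> f (\sum_i c i *: v i) = \sum_i c i *: f (v i).
Proof.
move=> fl; elim/big_rec2: _ => [|i y w _ <-]; last exact: fl.
(* Linearity at [1, 0, 0] reads [f 0 = f 0 + f 0], which settles the empty sum. *)
by have /eqP := fl 1 0 0; rewrite !scale1r addr0 -subr_eq subrr eq_sym => /eqP.
Qed.

Lemma pideal_refl (F : fieldType) (A : comAlgType F) (h : A) : h \in pideal h.
Proof. by apply/pidealP; exists 1; rewrite mul1r. Qed.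

(** * Laurent polynomials modulo a polynomial not vanishing at 0 *)

Section LaurentModPoly.
Variables (F : fieldType) (q : {poly F}).
Hypothesis q0 : ~~ root q 0.
Implicit Types (p : {poly F}) (u : laurent F).

Lemma poly_laurent_inj : injective (@poly_laurent F).
Proof. by move=> p r /(congr1 (@laurent_val F)) /eqP; rewrite tofrac_eq => /eqP. Qed.

Lemma coprimep_Xn k : coprimep q 'X^k.
Proof. by apply: coprimep_expr; rewrite -['X]subr0 -polyC0 coprimep_XsubC. Qed.

(** A Laurent cofactor [r / 'X^k] gives [r * q = p * 'X^k], and ['X^k] cancels by Gauss since it is
    coprime to [q]. *)
Lemma mem_pideal_poly p :
  (poly_laurent p \in pideal (poly_laurent q)) = (q %| p).
Proof.
apply/idP/idP => [/pidealP[v e]|/dvdpP[r ->]]; last first.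
  by apply/pidealP; exists (poly_laurent r); rewrite rmorphM.
have [r [k ev]] := laurent_polyP v.
rewrite -(Gauss_dvdpl _ (coprimep_Xn k)); apply/dvdpP; exists r.
apply: poly_laurent_inj; rewrite !rmorphM /= e ev -laurent_mon_nat.
by rewrite -[RHS]mulr1 -(laurent_mon0 F) -(subrr k%:Z) laurent_monD; ring.
Qed.

(** The variable is invertible modulo [q], so negative powers can be traded for polynomials;
    Euclidean division then bounds the degree. *)
Lemma pclass_poly u : exists2 p : {poly F}, (size p < size q)%N &
  pclass (poly_laurent q) u = pclass (poly_laurent q) (poly_laurent p).
Proof.
have q_neq0 : q != 0 by apply: contraNneq q0 => ->; apply: root0.
have [p [k ->]] := laurent_polyP u.
have /Bezout_eq1_coprimepP[[a b] /= ab] := coprimep_Xn k.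
(* By Bezout, [b] inverts ['X^k] modulo [q], so [w] represents [p / 'X^k]. *)
set w := p * b; exists (w %% q); first by rewrite ltn_modp.
set y := laurent_mon F (- k%:Z).
have wE : poly_laurent w = poly_laurent (w * 'X^k) * y.
  rewrite [in RHS]rmorphM /= -laurent_mon_nat -mulrA -laurent_monD.
  by rewrite subrr laurent_mon0 mulr1.
have pE : p = p * a * q + w * 'X^k.
  by rewrite /w -!mulrA -mulrDr ab mulr1.
apply/pclass_eqP/pidealP; exists (poly_laurent (w %/ q) + poly_laurent (p * a) * y).
rewrite {1}pE rmorphD mulrDl -wE {1}(divp_eq w q) rmorphD !rmorphM /=; ring.
Qed.

End LaurentModPoly.

Section LocalizedProduct.
Variables (R : realType) (n : nat).
Hypothesis n_gt1 : (1 < n)%N.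
Implicit Types (m l : 'Z_n).

Local Notation C := R[i].
Local Notation L := (laurent C).
Local Notation x := (laurent_mon C 1).
Local Notation xV := (laurent_mon C (- 1)).
Local Notation z := (zeta R n).

(** * Coordinates and classes in the localization *)

Definition Kcoord m l (b : Kloc R n) : pquot (Kl_gen R m l) := dproj m (dproj l b).

Definition Kclass m l (u : L) : Kloc R n := Kl_in (pclass (Kl_gen R m l) u).

Lemma KcoordP a b : (forall m l, Kcoord m l a = Kcoord m l b) -> a = b.
Proof. by move=> H; apply/dsumP => l; apply/dsumP => m; exact: H. Qed.

Lemma Kcoord_is_linear m l : linear (Kcoord m l).
Proof. by move=> c a b; rewrite /Kcoord (dprojP l c a b) dprojP. Qed.

HB.instance Definition _ m l :=
  GRing.isLinear.Build C (Kloc R n) (pquot (Kl_gen R m l)) *:%R (Kcoord m l)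
    (Kcoord_is_linear m l).

Lemma Kclass_is_linear m l : linear (Kclass m l).
Proof.
move=> c u v; rewrite /Kclass /Kl_in linearP.
rewrite (dinj_is_linear (V := Kl_summand R l) (i := m)).
exact: (dinj_is_linear (V := @Kl R n)).
Qed.

HB.instance Definition _ m l :=
  GRing.isLinear.Build C L (Kloc R n) *:%R (Kclass m l) (Kclass_is_linear m l).

Lemma Kcoord_class m l m' l' u : Kcoord m l (Kclass m' l' u) =
  if (m' == m) && (l' == l) then pclass (Kl_gen R m l) u else 0.
Proof.
rewrite /Kcoord /Kclass /Kl_in; have [<-|ll'] := eqVneq l' l; last first.
  by rewrite andbF (dproj_dinj_neq (V := @Kl R n)) // raddf0.
rewrite andbT (dproj_dinj (V := @Kl R n)).
have [<-|mm'] := eqVneq m' m; first by rewrite dproj_dinj.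
by rewrite (dproj_dinj_neq (V := Kl_summand R l')).
Qed.

Lemma Kclass_congr m l u v :
  u - v \in pideal (Kl_gen R m l) -> Kclass m l u = Kclass m l v.
Proof. by rewrite /Kclass => /pclass_eqP ->. Qed.

Lemma Kclass_eq0 m l u : u \in pideal (Kl_gen R m l) -> Kclass m l u = 0.
Proof. by rewrite -[u in u \in _]subr0 => /Kclass_congr->; rewrite linear0. Qed.

(** * Lifts along [Gamma] and Euler factors *)

Lemma Gamma_pclass m (f : L) :
  Gamma (KI_in (pclass (KI_gen R m) f)) = \sum_l Kclass m l f.
Proof.
apply: KcoordP => m' l; rewrite linear_sum (bigD1 l) //= big1 => [|l' /negbTE l'l].
  rewrite addr0 Kcoord_class eqxx andbT; have [<-|mm'] := eqVneq m m'.
    exact: Gamma_class.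
  rewrite /Kcoord GammaE (dproj_dinj_neq (V := @KI_summand R n)) //.
  by have := pmapE 0 (KI_gen_Kl R n_gt1 m' l); rewrite !raddf0.
by rewrite Kcoord_class l'l andbF.
Qed.

Lemma Gamma_inv_Kclass m l (u : L) : exists f,
  [/\ Gamma_inv (Kclass m l u) = KI_in (pclass (KI_gen R m) f),
      f - u \in pideal (Kl_gen R m l)
    & forall l', l' != l -> f \in pideal (Kl_gen R m l')].
Proof.
have [f fP] := crt_surj (comaximal_Kl_gen R n_gt1 m) (fun l' => if l' == l then u else 0).
have fl : f - u \in pideal (Kl_gen R m l) by have := fP l; rewrite eqxx.
have fl' l' : l' != l -> f \in pideal (Kl_gen R m l').
  by move=> /negbTE l'l; have := fP l'; rewrite l'l subr0.
exists f; split=> //; apply: (bij_inj (Gamma_bij R n_gt1)).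
rewrite Gamma_invK // Gamma_pclass (bigD1 l) //= big1 => [|l' /fl']; last first.
  exact: Kclass_eq0.
by rewrite addr0; apply/esym/Kclass_congr.
Qed.

(** A Laurent representative of [KI_euler], so that its class can be taken in any localized
    summand. *)
Definition euler m1 m2 : L :=
  if (m1 == 0) || (m2 == 0) then 1
  else if (m1 + m2 == n)%N then (1 - xV) ^+ 2 else 1 - xV.

Lemma eulerC m1 m2 : euler m1 m2 = euler m2 m1.
Proof. by rewrite /euler orbC addnC. Qed.

Lemma KI_eulerE m1 m2 : KI_euler R m1 m2 = pclass (KI_gen R (m1 + m2)) (euler m1 m2).
Proof.
rewrite /KI_euler /euler; case: ifP => _; first by rewrite rmorph1.
by case: ifP => _; rewrite ?rmorphXn rmorphB rmorph1.
Qed.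

Lemma vprod_pclass m1 m2 (f g : L) :
  vprod (KI_in (pclass (KI_gen R m1) f)) (KI_in (pclass (KI_gen R m2) g)) =
  KI_in (pclass (KI_gen R (m1 + m2)) (f * g * euler m1 m2)).
Proof. by rewrite vprod_in // KI_mul_class // KI_eulerE -rmorphM. Qed.

Lemma one_sub_xV : 1 - xV = xV * (x - 1).
Proof. by rewrite mulrBr mulr1 -laurent_monD addNr laurent_mon0. Qed.

Lemma Kl_gen_neq0 m l : (m, l) != (0, 0) -> Kl_gen R m l = x - (z ^+ l)%:A.
Proof. by rewrite xpair_eqE /Kl_gen => /negbTE ->. Qed.

Lemma Kl_gen00 : Kl_gen R (0 : 'Z_n) 0 = (x - 1) ^+ 2 :> L.
Proof. by []. Qed.

Lemma Kl_genl0 m : m != 0 -> Kl_gen R m 0 = x - 1.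
Proof. by move=> m0; rewrite Kl_gen_neq0 ?expr0 ?scale1r // xpair_eqE negb_and m0. Qed.

(** Each factor [1 - xV] is a unit times [x - 1]. A double zero at 1 is required only when
    [m1 + m2 = 0], and there the Euler factor is a square. *)
Lemma euler_twisted m1 m2 : m1 != 0 -> m2 != 0 ->
  euler m1 m2 \in pideal (Kl_gen R (m1 + m2) 0).
Proof.
move=> m10 m20; rewrite /euler (negbTE m10) (negbTE m20) one_sub_xV /=.
have [s0|s0] := eqVneq (m1 + m2) 0.
  by rewrite s0 Kl_gen00 (Zp_add_eq0 n_gt1 m10 s0) exprMn pidealM // pideal_refl.
rewrite (Kl_genl0 s0); case: ifP => _; last by rewrite pidealM // pideal_refl.
by rewrite expr2 mulrA pidealM // pideal_refl.
Qed.

(** At [zeta ^ 0] the ideal of the [m1]-summand need not lie in that of the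
    [m1 + m2]-summand; the Euler factor makes up for the difference. *)
Lemma Kl_gen_euler m1 m2 l u v :
  u \in pideal (Kl_gen R m1 l) -> u * v * euler m1 m2 \in pideal (Kl_gen R (m1 + m2) l).
Proof.
move=> /pidealP[w ->].
have -> : w * Kl_gen R m1 l * v * euler m1 m2 =
  w * v * (Kl_gen R m1 l * euler m1 m2) by ring.
apply: pidealM; have [->|l0] := eqVneq l 0; last first.
  by rewrite !Kl_gen_neq0 ?xpair_eqE ?negb_and ?l0 ?orbT // mulrC pidealM // pideal_refl.
have [->|m10] := eqVneq m1 0; first rewrite add0r mulrC pidealM //.
  have [->|m20] := eqVneq m2 0; first exact: pideal_refl.
  by rewrite (Kl_genl0 m20) Kl_gen00 expr2 pidealM // pideal_refl.
have [m20|m20] := eqVneq m2 0; first by rewrite m20 addr0 mulrC pidealM // pideal_refl.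
by rewrite pidealM // euler_twisted.
Qed.

(** * The transported product on classes and its table *)

Lemma Kprod_class m1 m2 l1 l2 u v : Kprod (Kclass m1 l1 u) (Kclass m2 l2 v) =
  if l1 == l2 then Kclass (m1 + m2) l1 (u * v * euler m1 m2) else 0.
Proof.
have [f [ef fu f0]] := Gamma_inv_Kclass m1 l1 u.
have [g [eg gv g0]] := Gamma_inv_Kclass m2 l2 v.
have gE l (a b : L) : a \in pideal (Kl_gen R m2 l) ->
    b * a * euler m1 m2 \in pideal (Kl_gen R (m1 + m2) l).
  by rewrite eulerC addrC (mulrC b); exact: Kl_gen_euler.
rewrite /Kprod ef eg vprod_pclass Gamma_pclass.
have [l12|l12] := eqVneq l1 l2; last first.
  (* At every point one of the two lifts vanishes: [g] at [l1], and [f] everywhere else. *)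
  apply: big1 => l _; apply: Kclass_eq0; have [->|/f0 fl] := eqVneq l l1.
    exact/gE/g0.
  exact: Kl_gen_euler.
rewrite -l12 in gv g0; rewrite (bigD1 l1) //= big1 => [|l /f0 fl]; last first.
  by apply: Kclass_eq0; exact: Kl_gen_euler.
rewrite addr0; apply: Kclass_congr.
(* The lifts are replaced by [u] and [v] one at a time. *)
have -> : f * g * euler m1 m2 - u * v * euler m1 m2 =
  (f - u) * g * euler m1 m2 + u * (g - v) * euler m1 m2 by ring.
by apply: rpredD; [exact: Kl_gen_euler | exact: gE].
Qed.

Lemma Gamma_inv_linear : linear (@Gamma_inv R n).
Proof.
move=> c a b; apply: (bij_inj (Gamma_bij R n_gt1)).
by rewrite Gamma_linear // !Gamma_invK.
Qed.

Lemma Kprod_bilinear : bilinear_for *:%R *:%R (@Kprod R n).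
Proof.
have [vl vr] := vprod_bilinear R n_gt1.
split=> [b|a] c u v; rewrite /Kprod Gamma_inv_linear.
  by rewrite vl Gamma_linear.
by rewrite vr Gamma_linear.
Qed.

Lemma K_oneE m l : K_one R m l = Kclass m l 1.
Proof. by []. Qed.

Lemma K_x00E : K_x00 R n = Kclass 0 0 x.
Proof. by []. Qed.

Lemma zetaX_neq0 k : z ^+ k != 0.
Proof.
have := prim_expr_order (zeta_prim R (ltnW n_gt1)).
move=> zn; rewrite expf_neq0 //; apply: contraTneq (ltnW n_gt1) => z0.
by move: zn; rewrite z0 expr0n; case: n => //= k' /esym/eqP; rewrite oner_eq0.
Qed.

Lemma Kclass_x_neq00 m l u : (m, l) != (0, 0) ->
  Kclass m l (x * u) = z ^+ l *: Kclass m l u.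
Proof.
move=> ml; rewrite -linearZ; apply: Kclass_congr; rewrite Kl_gen_neq0 //.
have -> : x * u - z ^+ l *: u = u * (x - (z ^+ l)%:A).
  by rewrite mulrBr mulr_algr mulrC.
by rewrite pidealM // pideal_refl.
Qed.

Lemma Kclass_one_sub_xV m l u : (m, l) != (0, 0) ->
  Kclass m l ((1 - xV) * u) = (1 - z ^- l) *: Kclass m l u.
Proof.
(* Multiplying [xV * u] by [x] scales its class by [z ^+ l], so [xV] itself acts as the inverse
   scalar. *)
move=> ml; have := Kclass_x_neq00 (xV * u) ml.
rewrite mulrA -laurent_monD subrr laurent_mon0 mul1r => e.
rewrite mulrBl mul1r linearB /= e scalerBl scale1r scalerA.
by rewrite mulVf ?zetaX_neq0 // scale1r.
Qed.

Lemma Kprod_table : product_table (@Kprod R n).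
Proof.
split; rewrite ?K_x00E ?K_oneE.
- by rewrite Kprod_class eqxx addr0 /euler eqxx !mulr1.
- by rewrite Kprod_class eqxx addr0 /euler eqxx mulr1 mul1r.
- rewrite Kprod_class eqxx addr0 /euler eqxx mulr1 -linearZ -linearB.
  apply: Kclass_congr; rewrite Kl_gen00.
  (* The relation holds because [x ^+ 2 - (2 x - 1)] is exactly the generator at [(0, 0)]. *)
  rewrite [X in X \in _](_ : _ = (x - 1) ^+ 2) ?pideal_refl //.
  by rewrite scaler_nat; ring.
- by move=> m m0; rewrite Kprod_class eqxx add0r /euler eqxx !mulr1.
- move=> m m0; rewrite Kprod_class eqxx add0r /euler eqxx !mulr1.
  by rewrite -[x]mulr1 Kclass_x_neq00 ?expr0 ?scale1r // xpair_eqE negb_and m0.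
- move=> m1 m2 m10 m20; rewrite Kprod_class eqxx !mul1r; apply: Kclass_eq0.
  exact: euler_twisted.
- by move=> m l; rewrite Kprod_class eqxx add0r /euler eqxx !mulr1.
- by move=> m l; rewrite eq_sym Kprod_class => /negbTE ->.
- move=> m1 m2 l s m10 m20.
  rewrite Kprod_class eqxx !mul1r /euler (negbTE m10) (negbTE m20) (negbTE s) /=.
  rewrite -[1 - xV]mulr1 Kclass_one_sub_xV // xpair_eqE.
  (* The target is not the [(0, 0)] summand: with [m1 != 0], a zero sum in ['Z_n] forces the natural
     sum to be [n]. *)
  apply: contraNN s => /andP[/eqP s _].
  exact: Zp_add_eq0.
- move=> m1 m2 l s m10 m20.
  have s0 : m1 + m2 = 0.
    by apply: val_inj; rewrite /= s Zp_cast // modnn.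
  have := euler_twisted m10 m20.
  rewrite Kprod_class eqxx !mul1r /euler (negbTE m10) (negbTE m20) s eqxx s0 /= => e0.
  (* At [l = 0] both sides vanish: the Euler factor lies in the ideal, and [1 - z ^- 0 = 0]. *)
  have [->|l0] := eqVneq l 0.
    by rewrite (Kclass_eq0 e0) expr0 invr1 subrr expr0n scale0r.
  have l00 : (0 : 'Z_n, l) != (0, 0) by rewrite xpair_eqE negb_and l0 orbT.
  by rewrite expr2 -[1 - xV in X in _ * X]mulr1 !Kclass_one_sub_xV // scalerA.
- by move=> m1 m2 l1 l2 /negbTE ll; rewrite Kprod_class ll.
Qed.

(** * The generators form a basis *)

Definition Kl_poly m l : {poly C} :=
  if (m == 0) && (l == 0) then ('X - 1%:P) ^+ 2 else 'X - (z ^+ l)%:P.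

Lemma Kl_polyE m l : Kl_gen R m l = poly_laurent (Kl_poly m l).
Proof.
rewrite /Kl_gen /Kl_poly; case: ifP => _; last by rewrite laurent_XsubC.
by rewrite rmorphXn /= laurent_XsubC scale1r.
Qed.

Lemma Kl_poly_root0 m l : ~~ root (Kl_poly m l) 0.
Proof.
rewrite /Kl_poly; case: ifP => _; last by rewrite root_XsubC eq_sym zetaX_neq0.
by rewrite root_exp_XsubC eq_sym oner_eq0.
Qed.

Lemma size_Kl_poly m l : size (Kl_poly m l) = ((m == 0) && (l == 0)).+2.
Proof.
rewrite /Kl_poly; case: ifP => _; last by rewrite size_XsubC.
by rewrite size_exp_XsubC.
Qed.

(** The [(0, 0)] summand has dimension 2, spanned by 1 and [x]; all others have dimension 1, hence
    the conditional linear term. *)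
Definition Kcoef_poly (c : {ffun option ('Z_n * 'Z_n) -> C}) m l : {poly C} :=
  (c (Some (m, l)))%:P + (if (m == 0) && (l == 0) then c None else 0) *: 'X.

Lemma Kcoord_generators (c : {ffun option ('Z_n * 'Z_n) -> C}) m l :
  Kcoord m l (\sum_g c g *: generator R g) =
  pclass (Kl_gen R m l) (poly_laurent (Kcoef_poly c m l)).
Proof.
(* Only [1_ml] and [x_00] can have a nonzero coordinate at [(m, l)]. *)
rewrite linear_sum (bigD1 (Some (m, l))) // (bigD1 None) //=.
rewrite big1 => [|[[m' l']|] //]; last first.
  rewrite andbT => ml; rewrite linearZ /= K_oneE Kcoord_class.
  case: ifP => [/andP[/eqP mm' /eqP ll']|_]; last exact: scaler0.
  by rewrite mm' ll' eqxx in ml.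
rewrite addr0 !linearZ /= K_oneE K_x00E !Kcoord_class !eqxx /=.
rewrite /Kcoef_poly -mul_polyC !rmorphD rmorphM /= -laurent_xE; congr (_ + _).
  by rewrite -linearZ; congr pclass; apply/mulr1.
rewrite !(eq_sym 0); case: ifP => _; last by rewrite scaler0 !rmorph0 mul0r rmorph0.
by rewrite -linearZ.
Qed.

(** In each summand the difference of the coefficient polynomials is divisible by [Kl_poly] but of
    smaller degree, hence zero. *)
Lemma generator_coef_inj (c c' : {ffun option ('Z_n * 'Z_n) -> C}) :
  \sum_g c g *: generator R g = \sum_g c' g *: generator R g -> c = c'.
Proof.
move=> cc'.
have E m l : Kcoef_poly c m l = Kcoef_poly c' m l.
  have := congr1 (Kcoord m l) cc'.
  rewrite !Kcoord_generators => /pclass_eqP.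
  rewrite -rmorphB Kl_polyE mem_pideal_poly ?Kl_poly_root0 // => dv.
  apply/eqP; rewrite -subr_eq0; apply: contraTT dv => /dvdp_leq lt.
  apply/negP => /lt; rewrite size_Kl_poly leqNgt => /negP; apply.
  rewrite ltnS /Kcoef_poly opprD addrACA -polyCB -scalerBl.
  rewrite (leq_trans (size_polyD _ _)) // geq_max (leq_trans (size_polyC_leq1 _)) //=.
  case: ifP => _; last by rewrite subr0 scale0r size_poly0.
  by rewrite (leq_trans (size_scale_leq _ _)) // size_polyX.
apply/ffunP => -[[m l]|].
  have /(congr1 (fun p : {poly C} => p`_0)) := E m l.
  by rewrite !coefD !coefC !coefZ !coefX !mulr0 !addr0.
have /(congr1 (fun p : {poly C} => p`_1)) := E 0 0.
by rewrite !coefD !coefC !coefZ !coefX !mulr1 !add0r.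
Qed.

Lemma generator_basis b : exists! c : {ffun option ('Z_n * 'Z_n) -> C},
  b = \sum_g c g *: generator R g.
Proof.
have H ml : exists p : {poly C}, (size p < size (Kl_poly ml.1 ml.2))%N /\
    Kcoord ml.1 ml.2 b = pclass (Kl_gen R ml.1 ml.2) (poly_laurent p).
  rewrite -[Kcoord _ _ b]preprK; move: (prepr _) => u; rewrite Kl_polyE.
  by have [p sp e] := pclass_poly (Kl_poly_root0 ml.1 ml.2) u; exists p.
have [p pP] := boolp.choice H.
(* The coefficients are those of the reduced representatives; [x_00] takes the linear one at
   [(0, 0)]. *)
pose c0 := [ffun g => if g is Some ml then (p ml)`_0 else (p (0, 0))`_1].
have bE : b = \sum_g c0 g *: generator R g.
  apply: KcoordP => m l; rewrite Kcoord_generators; have [sp ->] := pP (m, l).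
  congr (pclass _ (poly_laurent _)); rewrite /Kcoef_poly !ffunE.
  rewrite size_Kl_poly ltnS /= in sp.
  apply/polyP => i; rewrite coefD coefC coefZ coefX.
  case: i => [|[|i]]; rewrite ?mulr0 ?addr0 //= ?add0r ?mulr1.
    (* Outside [(0, 0)] the representative is constant, so its linear coefficient is 0. *)
    case: ifP sp => [/andP[/eqP-> /eqP->] //|_ sp].
    by rewrite nth_default.
  by rewrite nth_default // (leq_trans sp) //; case: andb.
by exists c0; split=> // c; rewrite bE; exact: generator_coef_inj.
Qed.

(** * Commutativity and uniqueness from the values on generators *)

Lemma bilinear_ext_generators (op op' : Kloc R n -> Kloc R n -> Kloc R n) :
  bilinear_for *:%R *:%R op -> bilinear_for *:%R *:%R op' ->
  (forall g g', op (generator R g) (generator R g') =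
    op' (generator R g) (generator R g')) ->
  op =2 op'.
Proof.
move=> [opl opr] [opl' opr'] E a b.
have [c [-> _]] := generator_basis a; have [d [-> _]] := generator_basis b.
rewrite (linear_expand _ _ (opl _)) (linear_expand _ _ (opl' _)).
apply: eq_bigr => g _; rewrite (linear_expand _ _ (opr _)) (linear_expand _ _ (opr' _)).
by congr (_ *: _); apply: eq_bigr => g' _; rewrite E.
Qed.

Lemma Kprod_comm : commutative (@Kprod R n).
Proof.
have [pl pr] := Kprod_bilinear.
(* The product is compared with its flip; on generators, which are all classes, [Kprod_class] is
   symmetric in its two arguments. *)
apply: (bilinear_ext_generators (op' := fun a b => Kprod b a)).
- exact: Kprod_bilinear.
- by split=> [b|a]; [exact: pr | exact: pl].
move=> g g'.
have [[m [l [u ->]]] [m' [l' [u' ->]]]] : (exists m l u, generator R g = Kclass m l u) /\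
  (exists m l u, generator R g' = Kclass m l u).
  split; [case: g => [[m l]|] | case: g' => [[m' l']|]].
  - by exists m, l, 1.
  - by exists 0, 0, x.
  - by exists m', l', 1.
  - by exists 0, 0, x.
rewrite !Kprod_class eq_sym; case: eqP => // ->.
by rewrite (addrC m') (eulerC m') (mulrC u').
Qed.

(** Up to order, every pair of generators falls under some entry of the table; commutativity
    supplies the reversed pairs. *)
Lemma product_table_generators (op op' : Kloc R n -> Kloc R n -> Kloc R n) :
  commutative op -> commutative op' -> product_table op -> product_table op' ->
  forall g g', op (generator R g) (generator R g') = op' (generator R g) (generator R g').
Proof.
move=> opC opC' T T'.
(* Pairs containing [x_00] are settled first, so that only pairs of identities remain. *)
have X g : op (K_x00 R n) (generator R g) = op' (K_x00 R n) (generator R g).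
  case: g => [[m l]|] /=; last by rewrite (op_x_x T) (op_x_x T').
  have [->|l0] := eqVneq l 0; last by rewrite (op_x_neq T) // (op_x_neq T').
  have [->|m0] := eqVneq m 0; last by rewrite (op_x_twisted T) // (op_x_twisted T').
  by rewrite opC opC' (op_one_x T) (op_one_x T').
move=> [[m l]|] g'; last exact: X.
case: g' => [[m' l']|]; last by rewrite opC opC' X.
rewrite /=; have [<-|ll'] := eqVneq l l'; last by rewrite (op_neq T) // (op_neq T').
have [->|m0] := eqVneq m 0; first by rewrite (op_unit T) (op_unit T').
have [->|m'0] := eqVneq m' 0; first by rewrite opC opC' (op_unit T) (op_unit T').
have [s|s] := eqVneq (m + m')%N n; first by rewrite (op_sum_eq T) // (op_sum_eq T').
by rewrite (op_sum_neq T) // (op_sum_neq T').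
Qed.

End LocalizedProduct.

Theorem proposition5p1 (R : realType) (n : nat) (n_ge2 : (2 <= n)%N) :
  [/\ forall b : Kloc R n,
        exists! c : {ffun option ('Z_n * 'Z_n) -> R[i]},
          b = \sum_g c g *: generator R g,
      bilinear_for *:%R *:%R (@Kprod R n),
      commutative (@Kprod R n),
      product_table (@Kprod R n)
    & forall op : Kloc R n -> Kloc R n -> Kloc R n,
        bilinear_for *:%R *:%R op -> commutative op -> product_table op ->
        op =2 @Kprod R n].
Proof.
split; [exact: generator_basis | exact: Kprod_bilinear | exact: Kprod_comm
  | exact: Kprod_table | move=> op opB opC opT].
apply: bilinear_ext_generators => //; first exact: Kprod_bilinear.
exact: (product_table_generators opC (Kprod_comm n_ge2) opT (Kprod_table R n_ge2)).
Qed.
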